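(* Let $\overline{A}=(A_1,\dots,A_X)$ and $\overline{C}=(C_1,\dots,C_Z)$ be cardinalities with spaces $\mathcal{A},\mathcal{C}$, and let $\Lambda:\mathcal{C}\to\mathcal{A}$ be a right invertible deterministic local map. Then there are a cardinality $\overline{B}$ with space $\mathcal{B}$ and deterministic local maps $\Lambda^{\mathrm R}:\mathcal{C}\to\mathcal{B}$ and $\Lambda^{\mathrm L}:\mathcal{B}\to\mathcal{A}$ such that $\Lambda=\Lambda^{\mathrm L}\,\Lambda^{\mathrm R}$, where: (i) $\Lambda^{\mathrm R}$ is a reordering/relabeling of inputs that does not affect outputs; (ii) $\Lambda^{\mathrm L}$ is a lifting (that is, an expression lifting) and has the elongated block diagonal form $$\Lambda^{\mathrm L}=\left(\begin{array}{c|c|c|c|c|c}L_1&0&\cdots&0&0&\cdots\\\hline0&0&&L_2&0&\cdots\\\hline\vdots&&&&&\end{array}\right),$$ that is, each block row $x\in\{1,\dots,X\}$ contains a single nonzero block $L_x$, located in block column $\kappa(x)$ for a strictly increasing map $\kappa$ with $\kappa(1)=1$ (so block columns containing only zeros may occur), and each block $L_x$ is right invertible.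
   Context: A cardinality $\overline{A}=(A_1,\dots,A_X)$ is a finite nonempty sequence of positive integers: a device has inputs $x\in\{1,\dots,X\}$ and, for input $x$, outputs $a\in\{1,\dots,A_x\}$. The associated space is $\mathcal{A}=\mathbb{R}^{A_1}\oplus\dots\oplus\mathbb{R}^{A_X}$ with coordinates indexed by pairs $(a,x)$. A deterministic local map $\mathcal{C}\to\mathcal{A}$ is determined by an input mapping $\xi:\{1,\dots,X\}\to\{1,\dots,Z\}$ and output mappings $\alpha_x:\{1,\dots,C_{\xi(x)}\}\to\{1,\dots,A_x\}$; its matrix has entry $\Lambda_{(a,x),(c,z)}=1$ if $z=\xi(x)$ and $a=\alpha_x(c)$, and $0$ otherwise. It is written as a block matrix with block rows indexed by target inputs, block columns indexed by source inputs, and blocks of size (number of target outputs) $\times$ (number of source outputs). A deterministic local map $\Lambda:\mathcal{C}\to\mathcal{A}$ is right invertible if there is a deterministic local map $\Lambda':\mathcal{A}\to\mathcal{C}$ with $\Lambda\circ\Lambda'=\mathrm{id}_{\mathcal A}$. The nonzero blocks of a deterministic local map are $0/1$ matrices with exactly one entry equal to $1$ in each column; such a block is right invertible if it has a right inverse that is a column-stochastic matrix, equivalently if each row has at least one entry $1$. Among the deterministic local maps having both a left and a right inverse, a relabeling is a permutation of inputs and outputs that does not modify the cardinality (an invertible deterministic local map $\mathcal{A}\to\mathcal{A}$), and a reordering is a permutation of inputs and outputs that modifies the cardinality up to a permutation (an invertible deterministic local map between spaces of cardinalities that are permutations of one another). An expression lifting is a right invertible deterministic local map that is neither a relabeling nor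 a reordering. A reordering/relabeling of inputs that does not affect outputs is a deterministic local map whose input mapping is a bijection and all of whose output mappings are identity maps.
   Formalization: That Λ^L is an expression lifting is asserted only when Λ is neither a relabeling nor a reordering, since otherwise (e.g. Λ the identity on cardinality (1)) Λ^L is itself invertible; its right invertibility and block form are asserted for every Λ. *)

(* Defs.v *)
(* MathComp world; real scalars are taken in an arbitrary [R : realType]. *)
From mathcomp Require Import all_boot all_order all_algebra.
From mathcomp Require Import reals.
Set Implicit Arguments.
Unset Strict Implicit.
Unset Printing Implicit Defensive.
Import Order.TTheory GRing.Theory Num.Theory.
Local Open Scope ring_scope.

Record cardinality := Cardinality {
  card_seq :> seq nat;
  card_seqP : (card_seq != [::]) && all (fun k => 0 < k)%N card_seq }.

Definition inputs (A : cardinality) : nat := size A.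

Definition outputs (A : cardinality) (x : 'I_(inputs A)) : nat :=
  tnth (in_tuple A) x.

(* The coordinates (a, x) of the space of A are ordered lexicographically,
   by x and then by a. *)
Definition dim (A : cardinality) : nat := (\sum_x outputs (A := A) x)%N.

(* A deterministic local map from the space of C to the space of A: its input
   mapping goes from the inputs of the target A to those of the source C. *)
Record dlm (C A : cardinality) := Dlm {
  inmap : 'I_(inputs A) -> 'I_(inputs C);
  outmap : forall x : 'I_(inputs A), 'I_(outputs (inmap x)) -> 'I_(outputs x) }.

Section Matrices.
Variable R : realType.

(* The equality test on z also transports a column index c of the block into
   the domain of the output mapping of x. *)
Definition dlm_block (C A : cardinality) (L : dlm C A)
    (x : 'I_(inputs A)) (z : 'I_(inputs C)) : 'M[R]_(outputs x, outputs z) :=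
  match @eqP _ z (inmap L x) with
  | ReflectT e =>
      \matrix_(a, c) (a == outmap (cast_ord (congr1 (@outputs C) e) c))%:R
  | ReflectF _ => 0
  end.

Definition dlm_mx (C A : cardinality) (L : dlm C A) : 'M[R]_(dim A, dim C) :=
  \mxblock_(x < inputs A, z < inputs C) dlm_block L x z.

Definition block (C A : cardinality) (M : 'M[R]_(dim A, dim C))
    (x : 'I_(inputs A)) (z : 'I_(inputs C)) : 'M[R]_(outputs x, outputs z) :=
  submxblock M x z.

Definition right_invertible (C A : cardinality) (L : dlm C A) : Prop :=
  exists L' : dlm A C, dlm_mx L *m dlm_mx L' = 1%:M.

Definition left_invertible (C A : cardinality) (L : dlm C A) : Prop :=
  exists L' : dlm A C, dlm_mx L' *m dlm_mx L = 1%:M.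

Definition invertible (C A : cardinality) (L : dlm C A) : Prop :=
  left_invertible L /\ right_invertible L.

Definition relabeling (C A : cardinality) (L : dlm C A) : Prop :=
  C = A /\ invertible L.

(* The permutation of the cardinality is allowed to be trivial, so that
   relabelings are also reorderings. *)
Definition reordering (C A : cardinality) (L : dlm C A) : Prop :=
  perm_eq C A /\ invertible L.

Definition expression_lifting (C A : cardinality) (L : dlm C A) : Prop :=
  [/\ right_invertible L, ~ relabeling L & ~ reordering L].

Definition column_stochastic (m n : nat) (S : 'M[R]_(m, n)) : Prop :=
  (forall i j, 0 <= S i j) /\ (forall j, \sum_i S i j = 1).

Definition block_right_invertible (m n : nat) (L : 'M[R]_(m, n)) : Prop :=
  exists S : 'M[R]_(n, m), column_stochastic S /\ L *m S = 1%:M.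

(* Inputs are numbered from 0, so the condition that the first block row has
   its nonzero block in the first block column reads kappa 0 = 0. *)
Definition elongated_block_diagonal (B A : cardinality)
    (M : 'M[R]_(dim A, dim B)) : Prop :=
  exists kappa : 'I_(inputs A) -> 'I_(inputs B),
    [/\ {homo kappa : x y / (x < y)%N},
        forall x : 'I_(inputs A), x = 0%N :> nat -> kappa x = 0%N :> nat,
        forall x z, z != kappa x -> block M x z = 0
      & forall x, block M x (kappa x) != 0 /\
                  block_right_invertible (block M x (kappa x))].

End Matrices.

Definition input_permutation (C B : cardinality) (L : dlm C B) : Prop :=
  bijective (inmap L) /\
  forall x, outputs x = outputs (inmap L x) /\
            forall c, outmap (d := L) (x := x) c = c :> nat.

(* Main.v *)
(** The matrix of a deterministic local map with input mapping xi has, in block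
    row x, the single nonzero block (x, xi x).  Comparing the blocks (x, x) of
    Lambda Lambda' = 1 forces xi' (xi x) = x and makes the block (xi x, x) of
    Lambda' a column-stochastic right inverse of the block (x, xi x) of Lambda.
    As xi is injective, the inputs of C can be listed as
    xi 0, xi 1, ... followed by the inputs outside the image of xi; after this
    renumbering xi becomes the inclusion of an initial segment.  Since the
    renumbering P is invertible, Lambda = Lambda^L P makes Lambda^L right
    invertible, and left invertible (a reordering) only if Lambda is. *)
Require Import Defs.
From mathcomp Require Import all_boot all_order all_algebra.
From mathcomp Require Import reals.
Set Implicit Arguments.
Unset Strict Implicit.
Unset Printing Implicit Defensive.
Import GRing.Theory Num.Theory.
Local Open Scope ring_scope.

Lemma outputs_gt0 (A : cardinality) (x : 'I_(inputs A)) : (0 < outputs x)%N.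
Proof.
have /andP[_ /allP] := card_seqP A; apply.
by rewrite /outputs (tnth_nth 0%N); apply: mem_nth.
Qed.

Definition dlm_comp (C B A : cardinality) (L : dlm B A) (M : dlm C B) :
    dlm C A :=
  @Dlm C A (fun x => inmap M (inmap L x)) (fun x c => outmap (outmap c)).

Definition dlm_id (A : cardinality) : dlm A A :=
  @Dlm A A (fun x => x) (fun x a => a).

Section Matrices.
Variable R : realType.

Lemma dlm_block_inmap (C A : cardinality) (L : dlm C A) x :
  dlm_block R L x (inmap L x) = \matrix_(a, c) (a == outmap c)%:R.
Proof.
rewrite /dlm_block; case: eqP => // e; apply/matrixP=> a c; rewrite !mxE.
by congr ((_ == outmap _)%:R); apply: val_inj.
Qed.

Lemma dlm_block_neq (C A : cardinality) (L : dlm C A) x z :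
  z != inmap L x -> dlm_block R L x z = 0.
Proof. by rewrite /dlm_block; case: eqP. Qed.

Lemma block_dlm_mx (C A : cardinality) (L : dlm C A) x z :
  block (dlm_mx R L) x z = dlm_block R L x z.
Proof. by rewrite /block /dlm_mx mxblockK. Qed.

Lemma column_stochastic_dlm_block (C A : cardinality) (L : dlm C A) x :
  column_stochastic (dlm_block R L x (inmap L x)).
Proof.
rewrite dlm_block_inmap; split=> [a c | c]; first by rewrite mxE ler0n.
rewrite (bigD1 (outmap c)) //= mxE eqxx big1 ?addr0 // => a.
by rewrite mxE => /negbTE ->.
Qed.

(** Column [c] of a nonzero block of [M] has its only 1 in row [outmap c], so the product picks out
    that column of the block of [L]. *)
Lemma dlm_block_comp (C B A : cardinality) (L : dlm B A) (M : dlm C B) x z :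
  dlm_block R (dlm_comp L M) x z =
  dlm_block R L x (inmap L x) *m dlm_block R M (inmap L x) z.
Proof.
have [-> | zN] := eqVneq z (inmap M (inmap L x)); last first.
  by rewrite !(dlm_block_neq (z := z)) ?mulmx0.
rewrite (dlm_block_inmap (dlm_comp L M)) !dlm_block_inmap.
apply/matrixP=> a c; rewrite !mxE (bigD1 (outmap c)) //= !mxE eqxx mulr1.
by rewrite big1 ?addr0 // => b /negbTE; rewrite !mxE => ->; rewrite mulr0.
Qed.

Lemma dlm_mx_comp (C B A : cardinality) (L : dlm B A) (M : dlm C B) :
  dlm_mx R (dlm_comp L M) = dlm_mx R L *m dlm_mx R M.
Proof.
rewrite /dlm_mx mul_mxblock; apply: eq_mxblock => x z.
rewrite dlm_block_comp (bigD1 (inmap L x)) //= big1 ?addr0 // => y yN.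
by rewrite dlm_block_neq // mul0mx.
Qed.

(** The output mappings have domains that agree only up to the equality of input mappings; comparing
    arguments as numbers avoids transport. *)
Lemma eq_dlm_mx (C A : cardinality) (L L' : dlm C A) :
    (forall x, inmap L x = inmap L' x) ->
    (forall x (c : 'I_(outputs (inmap L x))) (c' : 'I_(outputs (inmap L' x))),
       c = c' :> nat -> outmap c = outmap c') ->
  dlm_mx R L = dlm_mx R L'.
Proof.
move=> eq_in eq_out; apply: eq_mxblock => x z; rewrite /dlm_block.
case: eqP => [e | ne]; case: eqP => [e' | ne'] //; last 2 first.
- by case: ne'; rewrite -eq_in.
- by case: ne; rewrite eq_in.
apply/matrixP=> a c; rewrite !mxE; congr ((_ == _)%:R).
exact: eq_out.
Qed.

Lemma dlm_mx_id (A : cardinality) : dlm_mx R (dlm_id A) = 1%:M.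
Proof.
apply/mxblockP=> x z; rewrite -/(block _ x z) block_dlm_mx.
(* Equality of global indices splits into equality of inputs and equality of outputs. *)
apply/matrixP=> a c; rewrite !mxE -val_eqE tagnat.eq_Rank.
have [xz | xNz] := eqVneq x z; last first.
  by rewrite (dlm_block_neq (L := dlm_id A)) ?mxE // eq_sym.
by case: z / xz c => c; rewrite (dlm_block_inmap (dlm_id A)) mxE.
Qed.

Lemma right_invertible_blocks (C A : cardinality) (L : dlm C A) :
    right_invertible R L ->
  exists2 L' : dlm A C, cancel (inmap L) (inmap L')
    & forall x, dlm_block R L x (inmap L x) *m dlm_block R L' (inmap L x) x
                = 1%:M.
Proof.
case=> L'; rewrite -dlm_mx_comp -dlm_mx_id => LL'; exists L' => x.
all: have := congr1 (fun M => block M x x) LL'.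
all: rewrite !block_dlm_mx (dlm_block_inmap (dlm_id A)).
  (* Otherwise the diagonal block [(x, x)] of the product vanishes, whereas that of the identity has
     a 1 at [(a, a)]; such an [a] exists since outputs are nonempty. *)
  have [//|/dlm_block_neq -> /matrixP] := eqVneq x (inmap (dlm_comp L L') x).
  pose a := Ordinal (outputs_gt0 x).
  by move=> /(_ a a); rewrite !mxE eqxx => /esym/eqP; rewrite oner_eq0.
rewrite dlm_block_comp => ->.
by apply/matrixP=> a c; rewrite !mxE.
Qed.

Lemma block_right_invertible_dlm (C A : cardinality) (L : dlm C A) x :
    right_invertible R L ->
  block_right_invertible (dlm_block R L x (inmap L x)).
Proof.
case/right_invertible_blocks=> L' LK LL'.
exists (dlm_block R L' (inmap L x) x); split=> //.
have := column_stochastic_dlm_block L' (inmap L x).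
by rewrite LK.
Qed.

Lemma block_right_invertible_neq0 m n (M : 'M[R]_(m, n)) :
  (0 < m)%N -> block_right_invertible M -> M != 0.
Proof.
move=> m_gt0 [S [_ MS1]]; apply/eqP=> M0; move/matrixP: MS1.
move=> /(_ (Ordinal m_gt0) (Ordinal m_gt0)).
by rewrite M0 mul0mx !mxE eqxx => /esym/eqP; rewrite oner_eq0.
Qed.

(** The inverse bijection of inputs, with output mappings that are identities up to a cast, gives
    the left inverse. *)
Lemma input_permutation_left_invertible (C B : cardinality) (P : dlm C B) :
  input_permutation P -> left_invertible R P.
Proof.
case=> -[g PK gK] Pout.
have e z : outputs (g z) = outputs z.
  by rewrite (Pout (g z)).1 gK.
exists (@Dlm B C g (fun z => cast_ord (e z))).
rewrite -dlm_mx_comp -dlm_mx_id; apply: eq_dlm_mx => [z | z c c' cc'] /=.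
  exact: gK.
by apply: val_inj; rewrite /= (Pout _).2.
Qed.

End Matrices.

Lemma reorder_inputs (C : cardinality) n (xi : 'I_n -> 'I_(inputs C)) :
    injective xi ->
  exists (B : cardinality) (P : dlm C B) (kappa : 'I_n -> 'I_(inputs B)),
    [/\ input_permutation P, perm_eq C B, forall x, kappa x = x :> nat
      & forall x, inmap P (kappa x) = xi x].
Proof.
move=> xi_inj.
(* [codom] follows the order of the domain, so position [x < n] of [s] holds [xi x], and [widen_ord]
   can serve as [kappa]. *)
pose s := codom xi ++ [seq z <- enum 'I_(inputs C) | z \notin codom xi].
have s_uniq : uniq s.
  rewrite cat_uniq map_inj_uniq // enum_uniq filter_uniq ?enum_uniq // andbT.
  by apply/hasPn=> z; rewrite mem_filter => /andP[].
have s_all z : z \in s.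
  by rewrite mem_cat mem_filter mem_enum andbT orbN.
have CB : perm_eq C (map (@outputs C) s).
  have -> : card_seq C = map (@outputs C) (enum 'I_(inputs C)).
    by rewrite map_tnth_enum.
  apply/perm_map/uniq_perm => // [|z]; first exact: enum_uniq.
  by rewrite mem_enum s_all.
have B_card : (map (@outputs C) s != [::]) &&
              all (fun k => 0 < k)%N (map (@outputs C) s).
  rewrite -(perm_all _ CB) -size_eq0 -(perm_size CB) size_eq0.
  exact: card_seqP.
pose B := Cardinality B_card.
have sB : inputs B = size s by rewrite /inputs size_map.
pose p (y : 'I_(inputs B)) := tnth (in_tuple s) (cast_ord sB y).
have e y : outputs y = outputs (p y).
  have z0 := p y.
  rewrite {1}/outputs (tnth_nth 0%N) (nth_map z0) -?sB //.
  by rewrite /p (tnth_nth z0).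
have le_n : (n <= inputs B)%N.
  by rewrite sB size_cat size_codom card_ord leq_addr.
exists B, (@Dlm C B p (fun y => cast_ord (esym (e y)))), (widen_ord le_n).
split=> //= [|x]; first split=> //=.
  (* [p] is injective because [s] has no duplicates, and both sides have equally many inputs. *)
  apply: inj_card_bij; last by rewrite !card_ord {1}/inputs (perm_size CB).
  by move=> y y' /(tuple_uniqP (in_tuple s) s_uniq)/cast_ord_inj.
have z0 := xi x.
rewrite /p (tnth_nth z0) /= nth_cat size_codom card_ord ltn_ord.
by rewrite (nth_map x) ?size_enum_ord // nth_ord_enum.
Qed.

Theorem proposition23 (R : realType) (A C : cardinality) (Lam : dlm C A)
    (Lam_rinv : right_invertible R Lam) :
  exists (B : cardinality) (LamR : dlm C B) (LamL : dlm B A),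
    [/\ dlm_mx R Lam = dlm_mx R LamL *m dlm_mx R LamR,
        input_permutation LamR,
        right_invertible R LamL,
        ~ relabeling R Lam -> ~ reordering R Lam -> expression_lifting R LamL
      & elongated_block_diagonal (dlm_mx R LamL)].
Proof.
have [Lam' LamK _] := right_invertible_blocks Lam_rinv.
have [B [P [kappa [permP CB kappaE Pkappa]]]] := reorder_inputs (can_inj LamK).
have e x : outputs (kappa x) = outputs (inmap Lam x).
  by rewrite (permP.2 _).1 Pkappa.
(* As [P] preserves outputs, the output mappings of [Lam] can be reused unchanged. *)
pose LamL := @Dlm B A kappa (fun x b => outmap (cast_ord (e x) b)).
have LamE : dlm_mx R Lam = dlm_mx R LamL *m dlm_mx R P.
  rewrite -dlm_mx_comp; apply: eq_dlm_mx => [x | x c c' cc'] /=.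
    by rewrite Pkappa.
  by congr outmap; apply: val_inj; rewrite /= (permP.2 _).2.
have LamL_rinv : right_invertible R LamL.
  case: Lam_rinv => M LamM; exists (dlm_comp P M).
  by rewrite dlm_mx_comp mulmxA -LamE.
exists B, P, LamL; split=> //; last first.
  exists kappa; split=> [x y | x x0 | x z zN | x]; rewrite ?kappaE //.
    by rewrite block_dlm_mx dlm_block_neq.
  rewrite block_dlm_mx; have Lx := block_right_invertible_dlm x LamL_rinv.
  by split=> //; apply: block_right_invertible_neq0 Lx; apply: outputs_gt0.
move=> _ notreo.
have notreoL : ~ reordering R LamL.
  (* If [M] inverts [LamL] on the left and [Q] inverts [P] on the left, then [Q M] inverts [Lam] on
     the left. *)
  case=> BA [[M MLamL] _]; apply: notreo; split; first exact: perm_trans BA.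
  split=> //; have [Q QP] := input_permutation_left_invertible R permP.
  exists (dlm_comp Q M).
  by rewrite LamE dlm_mx_comp mulmxA -(mulmxA _ _ (dlm_mx R LamL)) MLamL mulmx1.
(* A relabeling is a reordering with trivial permutation, so it is excluded as well. *)
by split=> // -[BA LamL_inv]; apply: notreoL; split=> //; rewrite BA.
Qed.
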